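(* Let $\bar x\in\mathbb{R}^n$ be a nonstationary point of the set optimization problem $\preceq^{\ell}\text{-}\min_{x\in\mathbb{R}^n}F(x)$, where $F(x)=\{f^1(x),\dots,f^p(x)\}$. Let $(\bar a,\bar u)$ be a minimizer of $\mathcal{V}_{\bar x}$ over $P_{\bar x}\times\mathbb{R}^n$, write $\bar\omega=\omega(\bar x)$, and let $\bar d\in\mathbb{R}^n$ be a $K$-descent direction at $\bar x$, i.e. $\max_{j\in[\bar\omega]}\phi(\nabla f^{\bar a_j}(\bar x)^{\top}\bar d)<0$. Assume that there exists a bounded set $\mathcal{B}\subseteq\mathbb{R}^m$ such that $\mathcal{B}\preceq^{\ell}F(x)$ for all $x\in\mathbb{R}^n$, and let $e\in\mathrm{int}(K)$, $\rho\in(0,1)$ and $\sigma\in(\rho,1)$. Then there exists an interval $I\subset\mathbb{R}_{++}=(0,\infty)$ such that every $\alpha\in I$ satisfies the strong Wolfe conditions $$F(\bar x+\alpha\bar d)\ \preceq^{\ell}\ \Big\{f^{\bar a_j}(\bar x)+\rho\,\alpha\,\Big(\max_{i\in[\bar\omega]}\phi\big(\nabla f^{\bar a_i}(\bar x)^{\top}\bar d\big)\Big)e\Big\}_{j\in[\bar\omega]}\ \prec^{\ell}\ F(\bar x)$$ and $$\Big|\max_{j\in[\bar\omega]}\phi\big(\nabla f^{\bar a_j}(\bar x+\alpha\bar d)^{\top}\bar d\big)\Big|\ \le\ \sigma\,\Big|\max_{j\in[\bar\omega]}\phi\big(\nabla f^{\bar a_j}(\bar x)^{\top}\bar d\big)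\Big|.$$
   Context: $K\subset\mathbb{R}^m$ is a closed, convex, pointed ($K\cap(-K)=\{0\}$) cone with nonempty interior. For $U,V\subseteq\mathbb{R}^m$: $U\preceq^{\ell}V$ iff $V\subseteq U+K$, and $U\prec^{\ell}V$ iff $V\subseteq U+\mathrm{int}(K)$. The maps $f^1,\dots,f^p:\mathbb{R}^n\to\mathbb{R}^m$ are continuously differentiable, and $F(x)=\{f^1(x),\dots,f^p(x)\}$. $[q]=\{1,\dots,q\}$. $\nabla f^j(x)^{\top}d\in\mathbb{R}^m$ denotes the derivative (Jacobian) of $f^j$ at $x$ applied to $d$. Dual cone: $K^*=\{w\in\mathbb{R}^m: y^{\top}w\ge0\ \forall y\in K\}$. With the same fixed $e\in\mathrm{int}(K)$ as in the claim, $C=\{w\in K^*: w^{\top}e=1\}$ (a compact set), and $\phi(y)=\sup\{w^{\top}y: w\in C\}$ for $y\in\mathbb{R}^m$. Minimal elements: $\mathrm{Min}(B,K)=\{y\in B: B\cap(y-K)=\{y\}\}$. Put $\omega(x)=|\mathrm{Min}(F(x),K)|$, enumerate $\mathrm{Min}(F(x),K)=\{v^x_1,\dots,v^x_{\omega(x)}\}$, let $I_{v}(x)=\{i\in[p]: f^i(x)=v\}$ for $v\in\mathrm{Min}(F(x),K)$, and define the partition set $P_x=\prod_{j=1}^{\omega(x)}I_{v^x_j}(x)$; its elements are written $a=(a_1,\dots,a_{\omega(x)})$. A point $\bar x$ is stationary if for each $a\in P_{\bar x}$ and each $d\in\mathbb{R}^n$ there is $j\in[\omega(\bar x)]$ with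 $\nabla f^{a_j}(\bar x)^{\top}d\notin-\mathrm{int}(K)$; otherwise it is nonstationary. $\mathcal{V}_x(a,d)=\max_{j\in[\omega(x)]}\phi(\nabla f^{a_j}(x)^{\top}d)+\tfrac12\|d\|^2$ for $(a,d)\in P_x\times\mathbb{R}^n$ (with $\|\cdot\|$ the Euclidean norm); it attains its minimum over $P_x\times\mathbb{R}^n$. *)

(* Defs.v *)
From HB Require Import structures.
From mathcomp Require Export all_boot all_order all_algebra.
From mathcomp Require Export finmap.
From mathcomp Require Export all_classical all_reals all_analysis.

Export Order.TTheory GRing.Theory Num.Theory.
Export numFieldNormedType.Exports.

Set Implicit Arguments.
Unset Strict Implicit.
Unset Printing Implicit Defensive.

Local Open Scope classical_set_scope.
Local Open Scope ring_scope.

(* Vectors of R^n are row vectors ['rV[R]_n]; their library norm is the sup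
   norm, which induces the usual topology.  The Euclidean norm is [enorm]. *)
Definition dot (R : realType) n (u v : 'rV[R]_n) : R :=
  \sum_(i < n) u ord0 i * v ord0 i.

Definition enorm (R : realType) n (u : 'rV[R]_n) : R := Num.sqrt (dot u u).

(* The maximum of a nonempty finite family, see [fmaxP]; it is 0 when k = 0. *)
Definition fmax (R : realType) k (g : 'I_k -> R) : R := sup (range g).

Lemma fmaxP (R : realType) k (g : 'I_k -> R) : (0 < k)%N ->
  (exists j, fmax g = g j) /\ (forall j, g j <= fmax g).
Proof.
case: k g => // k g _.
pose j0 := [arg max_(j > ord0 | true) g j]%O.
have gj0 j : g j <= g j0.
  by rewrite /j0; case: arg_maxP => // i _; apply.
suff -> : fmax g = g j0 by split; [exists j0|].
apply/eqP; rewrite eq_le; apply/andP; split.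
  by apply: ge_sup => [|_ [j _ <-]//]; exists (g j0), j0.
by apply: ub_le_sup; [exists (g j0) => _ [j _ <-]|exists j0].
Qed.

Section Cone.
Variables (R : realType) (m : nat).
Implicit Types (K U V B : set 'rV[R]_m) (e y w : 'rV[R]_m).

Definition is_cone K := forall (t : R) y, 0 <= t -> K y -> K (t *: y).

Definition pointed K := K `&` [set - y | y in K] = [set 0].

Definition ordering_cone K :=
  [/\ is_cone K, closed K, convex_set K, pointed K & K° !=set0].

Definition set_add U V : set 'rV[R]_m := [set u + v | u in U & v in V].

Definition lower_le K U V := V `<=` set_add U K.

Definition lower_lt K U V := V `<=` set_add U K°.

Definition dual_cone K : set 'rV[R]_m :=
  [set w | forall y, K y -> 0 <= dot y w].

Definition dual_base K e : set 'rV[R]_m :=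
  [set w | dual_cone K w /\ dot w e = 1].

Definition phi K e y : R := sup [set dot w y | w in dual_base K e].

Definition Min B K : set 'rV[R]_m :=
  [set y | B y /\ B `&` [set y - k | k in K] = [set y]].

End Cone.

(* [jacobian g x] is the n x m matrix whose transpose is the usual Jacobian. *)
Definition cont_diff (R : realType) n m (g : 'rV[R]_n -> 'rV[R]_m) :=
  (forall x, differentiable g x) /\ continuous (jacobian g).

Section SetProblem.
Variables (R : realType) (n m p : nat) (K : set 'rV[R]_m).
Variable f : 'I_p -> 'rV[R]_n -> 'rV[R]_m.

Definition Fset (x : 'rV[R]_n) : set 'rV[R]_m := range (f ^~ x).

Definition omega (x : 'rV[R]_n) : nat := #|` fset_set (Min (Fset x) K)|.

(* [v] enumerates the minimal elements of F(x) without repetition. *)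
Definition enum_Min x (v : 'I_(omega x) -> 'rV[R]_m) :=
  set_bij [set: 'I_(omega x)] (Min (Fset x) K) v.

Definition Iset (x : 'rV[R]_n) (y : 'rV[R]_m) : set 'I_p :=
  [set i | f i x = y].

Definition Pset x (v : 'I_(omega x) -> 'rV[R]_m) :
    set ('I_(omega x) -> 'I_p) :=
  [set a | forall j, Iset x (v j) (a j)].

Definition stationary x (v : 'I_(omega x) -> 'rV[R]_m) :=
  forall a, Pset v a -> forall d : 'rV[R]_n,
    exists j, ~ [set - y | y in K°] ('d (f (a j)) x d).

Definition max_slope (e : 'rV[R]_m) k (a : 'I_k -> 'I_p) (x d : 'rV[R]_n) : R :=
  fmax (fun j => phi K e ('d (f (a j)) x d)).

Definition Vfun (e : 'rV[R]_m) x (a : 'I_(omega x) -> 'I_p) (d : 'rV[R]_n) : R :=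
  max_slope e a x d + 2^-1 * enorm d ^+ 2.

Definition V_minimizer (e : 'rV[R]_m) x (v : 'I_(omega x) -> 'rV[R]_m)
    (a : 'I_(omega x) -> 'I_p) (u : 'rV[R]_n) :=
  Pset v a /\ forall a' u', Pset v a' -> Vfun e a u <= Vfun e a' u'.

End SetProblem.

(* Main.v *)
(* Write D < 0 for the initial slope and M(t) for the slope at xbar + t dbar.
   Every w in the dual base C satisfies w^T y <= phi(y), so if M stayed below
   rho D on the whole half-line, each w^T f^{a_j} would tend to -oo along it,
   against the lower bound given by B.  Hence there is a first a > 0 with
   M(a) >= rho D.  As M(a) > sigma D, the bound M > sigma D persists on some
   ]l, a[, which yields the curvature condition there.  For t in ]l, a[ one has
   M < rho D on [0, t], so the mean value theorem gives
   w^T f^{a_j}(xbar + t dbar) <= w^T f^{a_j}(xbar) + rho t D for all w in C;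
   by duality (K is cut out by C) this is the sufficient decrease condition.
   The remaining relation holds because every element of the finite set
   F(xbar) dominates a minimal one. *)
From HB Require Import structures.
From mathcomp Require Import ring lra.
Require Import Defs.

Set Implicit Arguments.
Unset Strict Implicit.
Unset Printing Implicit Defensive.

Local Open Scope classical_set_scope.
Local Open Scope ring_scope.

(** * The dot product, and finite maxima of continuous functions *)

Section Dot.
Variables (R : realType) (m : nat).
Implicit Types (u v w y : 'rV[R]_m).

Lemma dotC u v : dot u v = dot v u.
Proof. by apply: eq_bigr => i _; rewrite mulrC. Qed.

Fact dot_is_linear w : linear (dot w).
Proof.
move=> t u v; rewrite /dot scaler_sumr -big_split /=.
by apply: eq_bigr => i _; rewrite !mxE mulrDr mulrCA.
Qed.

HB.instance Definition _ w :=
  GRing.isLinear.Build R 'rV[R]_m R *%R (dot w) (dot_is_linear w).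

Lemma dot_continuous w : continuous (dot w).
Proof.
apply: (continuous_big add_continuous) => i _ y.
exact: (continuous_comp (@coord_continuous R 1 m ord0 i y)
  (@mulrl_continuous R _ _)).
Qed.

Lemma dot_ge0 u : 0 <= dot u u.
Proof. by apply: sumr_ge0 => i _; rewrite -expr2 sqr_ge0. Qed.

Lemma coord_sqr_le_dot u i : u ord0 i ^+ 2 <= dot u u.
Proof.
rewrite /dot (bigD1 i) //= -expr2 lerDl.
by apply: sumr_ge0 => j _; rewrite -expr2 sqr_ge0.
Qed.

Lemma dot_gt0 u : u != 0 -> 0 < dot u u.
Proof.
move=> u0; rewrite lt_neqAle dot_ge0 andbT eq_sym; apply: contra u0 => /eqP d0.
apply/eqP/rowP => i; rewrite mxE; apply/eqP; rewrite -sqrf_eq0.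
by rewrite eq_le sqr_ge0 andbT -d0 coord_sqr_le_dot.
Qed.

Lemma dotN2 u : dot (- u) (- u) = dot u u.
Proof. by rewrite linearN /= [dot (- u) u]dotC linearN opprK. Qed.

Lemma dotD2 u v : dot (u + v) (u + v) = dot u u + 2 * dot u v + dot v v.
Proof.
rewrite linearD /= ![dot (u + v) _]dotC !linearD /= (dotC v u).
by ring.
Qed.

(** The norm of [y] is the sup norm, so its dual, the sum of the [|w_i|], appears as the
    constant. *)
Lemma norm_dot_le w y : `|dot w y| <= (\sum_i `|w ord0 i|) * `|y|.
Proof.
rewrite mulr_suml; apply: le_trans (ler_norm_sum _ _ _) _.
apply: ler_sum => i _; rewrite normrM ler_wpM2l//.
by rewrite /Num.norm /= mx_normrE (le_bigmax _ _ (ord0, i)).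
Qed.

End Dot.

(** Each of the two maxima is attained at some index; comparing both functions at that index gives
    one of the two inequalities. *)
Lemma fmax_continuous (R : realType) k (g : 'I_k -> R -> R) :
  (forall j, continuous (g j)) -> continuous (fun t => fmax (g ^~ t)).
Proof.
case: k g => [|k] g gc t.
  rewrite (_ : (fun _ => _) = cst (fmax (g ^~ t))); first exact: cvg_cst.
  by apply/funext => s; congr fmax; apply/funext => -[].
apply/cvgrPdist_le => eps e0.
have gnear j : \forall s \near t, `|g j t - g j s| <= eps.
  by move/cvgrPdist_le : (gc j t); exact.
apply: filterS (filter_forall (nbhs_filter t) gnear) => s hs.
have [[i ti] tle] := fmaxP (g ^~ t) (ltn0Sn k).
have [[j sj] sle] := fmaxP (g ^~ s) (ltn0Sn k).
rewrite ler_distlC; apply/andP; split.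
  by have := sle i; have := hs i; rewrite ler_distlC ti => /andP[? ?] ?; lra.
by have := tle j; have := hs j; rewrite ler_distlC sj => /andP[? ?] ?; lra.
Qed.

(** * Arithmetic of an ordering cone and its interior *)

Section OrderingCone.
Variables (R : realType) (m : nat) (K : set 'rV[R]_m).
Hypothesis hK : ordering_cone K.
Implicit Types (e u w y : 'rV[R]_m).

Lemma coneZ (t : R) y : 0 <= t -> K y -> K (t *: y).
Proof. by case: hK => + _ _ _ _; apply. Qed.

Lemma coneD u y : K u -> K y -> K (u + y).
Proof.
case: hK => _ _ cvx _ _ Ku Ky.
have h0 : 0 <= (2^-1 : R) by lra.
have h1 : (2^-1 : R) <= 1 by lra.
have : K (2^-1 *: u + (1 - 2^-1) *: y).
  exact: set_mem (cvx u y (Itv01 h0 h1) (mem_set Ku) (mem_set Ky)).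
move=> /(coneZ (ler0n _ 2)); rewrite scalerDr !scalerA.
have -> : 2 * 2^-1 = 1 :> R by field.
by have -> : 2 * (1 - 2^-1) = 1 :> R; [field|rewrite !scale1r].
Qed.

Lemma cone0 : K 0.
Proof.
case: hK => + _ _ _ [y /interior_subset Ky].
by move=> /(_ 0 y (lexx _) Ky); rewrite scale0r.
Qed.

Lemma cone_antisym y : K y -> K (- y) -> y = 0.
Proof.
case: hK => _ _ _ hp _ Ky KNy.
suff : [set (0 : 'rV[R]_m)] y by [].
by rewrite -hp; split=> //; exists (- y) => //; rewrite opprK.
Qed.

Lemma interior_coneP e : K° e ->
  exists2 r : R, 0 < r & forall h, `|h| < r -> K (e - h).
Proof.
move=> /nbhs_ballP[r r0 sub]; exists r => // h hr; apply: sub.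
by rewrite -ball_normE /= opprB addrC subrK.
Qed.

(** A ball of radius [r] about [e] inside [K], scaled by [t] and shifted by [y], is a ball of radius
    [t * r] inside [K]. *)
Lemma cone_interiorD (t : R) e y : 0 < t -> K° e -> K y -> K° (y + t *: e).
Proof.
move=> t0 /interior_coneP[r r0 sub] Ky; apply/nbhs_ballP.
exists (t * r); first exact: mulr_gt0.
move=> z; rewrite -ball_normE /= => zr.
have -> : z = y + t *: (e - t^-1 *: (y + t *: e - z)).
  rewrite scalerBr scalerA divff ?gt_eqF// scale1r.
  by apply/rowP => i; rewrite !mxE; ring.
apply: coneD => //; apply: coneZ (ltW t0) _; apply: sub.
by rewrite normrZ gtr0_norm ?invr_gt0// mulrC ltr_pdivrMr// mulrC.
Qed.

Lemma interior_cone_absorb e y : K° e -> exists2 t : R, 0 < t & K (t *: e - y).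
Proof.
move=> /interior_coneP[r r0 sub]; have [->|y0] := eqVneq y 0.
  exists 1 => //; rewrite scale1r; apply: sub.
  by rewrite normr0.
(* With this [t] the vector [t^-1 *: y] has norm [r / 2], so subtracting it from [e] stays inside
   the ball. *)
pose t := 2 * `|y| / r.
have ny0 : 0 < `|y| by rewrite normr_gt0.
have t0 : 0 < t by rewrite /t; do 2?apply: mulr_gt0; rewrite ?invr_gt0.
exists t => //.
rewrite (_ : y = t *: (t^-1 *: y)); last first.
  by rewrite scalerA divff ?scale1r ?gt_eqF.
rewrite -scalerBr; apply: coneZ (ltW t0) _; apply: sub.
rewrite normrZ gtr0_norm ?invr_gt0// mulrC ltr_pdivrMr// /t.
by rewrite mulrCA divff ?gt_eqF//; lra.
Qed.

End OrderingCone.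

(** * Separation from a closed cone, the dual base and its support function [phi] *)

Lemma sqdist_continuous (R : realType) m (y : 'rV[R]_m) :
  continuous (fun u : 'rV[R]_m => dot (y - u) (y - u)).
Proof.
apply: (continuous_big add_continuous) => i _ u.
have cy : {for u, continuous (fun v : 'rV[R]_m => y - v)}.
  by apply: continuousB; [exact: cst_continuous|exact: cvg_id].
have cu : {for u, continuous (fun v : 'rV[R]_m => (y - v) ord0 i)}.
  exact: (continuous_comp cy (@coord_continuous R 1 m ord0 i _)).
exact: (continuousM cu cu).
Qed.

(** Makes sublevel sets of the squared Euclidean distance bounded for the sup norm. *)
Lemma norm_le_dot (R : realType) m (u : 'rV[R]_m) : `|u| <= 1 + dot u u.
Proof.
rewrite /Num.norm /= mx_normrE; apply: bigmax_le.
  by rewrite addr_ge0// dot_ge0.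
move=> -[i j] _ /=; rewrite [i]ord1.
apply: le_trans (lerD (lexx _) (coord_sqr_le_dot u j)).
rewrite -real_normK ?num_real//.
by have := sqr_ge0 (`|u ord0 j| - 1); nra.
Qed.

Lemma quad_ge0_slope (R : realFieldType) (a b : R) : 0 <= b ->
  (forall t, 0 <= t <= 1 -> 0 <= 2 * t * a + t ^+ 2 * b) -> 0 <= a.
Proof.
move=> b0 h; rewrite leNgt; apply/negP => a0.
have ba0 : 0 < b - a by lra.
(* The denominator [b - a] keeps [t] in []0, 1]] even for [b = 0]; as [t * b <= - a], the quadratic
   is at most [t * a < 0]. *)
pose t := - a / (b - a).
have tE : t * (b - a) = - a by rewrite /t mulfVK// gt_eqF.
have t0 : 0 < t by rewrite divr_gt0// oppr_gt0.
have t1 : t <= 1 by rewrite ler_pdivrMr//; lra.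
have := h t; rewrite t1 ltW// => /(_ isT); rewrite leNgt => /negP; apply.
have : t * b <= - a by nra.
by nra.
Qed.

Section Duality.
Variables (R : realType) (m : nat) (K : set 'rV[R]_m).
Hypothesis hK : ordering_cone K.
Implicit Types (e u w y : 'rV[R]_m).

(* [w] is [z - y] for [z] the point of [K] closest to [y]. *)
Lemma cone_separation y : ~ K y -> exists2 w, dual_cone K w & dot w y < 0.
Proof.
move=> nKy; pose q (k : 'rV[R]_m) := dot (y - k) (y - k).
have qc : continuous q by exact: sqdist_continuous.
(* Cutting [K] at the level of the point 0 gives a compact set without losing the minimizer. *)
pose A := K `&` [set k | q k <= q 0].
have A0 : A 0 by split; [exact: (cone0 hK)|exact: lexx].
have cA : closed A.
  apply: closedI; first by case: hK.
  apply: (@preimage_closed _ _ q [set t | t <= q 0]); last exact: closed_le.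
  by move=> ? _; exact: qc.
have bA : bounded_set A.
  exists (`|y| + (1 + q 0)); split; first exact: num_real.
  move=> M hM k [_ qk]; apply: le_trans (ltW hM).
  rewrite (_ : k = y - (y - k)); last by rewrite opprB addrC subrK.
  apply: le_trans (ler_normB _ _) _; rewrite lerD2l.
  by apply: le_trans (norm_le_dot _) _; rewrite lerD2l.
have [z /set_mem[Kz _] zmin] :=
  EVT_min_rV (ex_intro _ 0 A0) (bounded_closed_compact bA cA)
    (continuous_subspaceT qc).
have {}zmin k : K k -> q z <= q k.
  move=> Kk; have [qk|qk] := leP (q k) (q 0).
    by apply: zmin; rewrite inE.
  by apply: le_trans (ltW qk); apply: zmin; rewrite inE.
pose w := z - y.
(* First-order optimality of [z] along any direction [h] that stays in [K]; it is used below for [h]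
   in [K] and for [h = - z]. *)
have wh (h : 'rV[R]_m) :
    (forall t, 0 <= t <= 1 -> K (z + t *: h)) -> 0 <= dot w h.
  move=> hh; apply: (quad_ge0_slope (dot_ge0 h)) => t /hh /zmin.
  have -> : q z = dot w w by rewrite /q -dotN2 opprB.
  have -> : q (z + t *: h) = dot (w + t *: h) (w + t *: h).
    by rewrite /q -dotN2; congr dot; apply/rowP => i; rewrite !mxE; ring.
  by rewrite dotD2 !linearZ /= [dot (t *: h) h]dotC linearZ /=; lra.
have w0 : w != 0 by apply/eqP => /subr0_eq zy; apply: nKy; rewrite -zy.
exists w.
  move=> k Kk; rewrite dotC; apply: wh => t /andP[t0 _].
  by apply: coneD => //; exact: coneZ.
have wz : dot w z <= 0.
  rewrite -oppr_ge0 -linearN; apply: wh => t /andP[t0 t1].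
  rewrite (_ : z + _ = (1 - t) *: z); last by rewrite scalerBl scale1r scalerN.
  by apply: coneZ => //; lra.
have : dot w w = dot w z - dot w y by rewrite -linearB.
by have := dot_gt0 w0; lra.
Qed.

(** Absorbing [w] itself, [t *: e - w] lies in [K]; pairing it with [w] gives
    [t * dot w e >= dot w w > 0]. *)
Lemma dual_cone_interior_gt0 e w : K° e -> dual_cone K w -> w != 0 ->
  0 < dot w e.
Proof.
move=> he Kw w0; have [t t0 /Kw] := interior_cone_absorb hK w he.
rewrite dotC linearB linearZ /= subr_ge0 => /(lt_le_trans (dot_gt0 w0)).
by rewrite (pmulr_rgt0 _ t0).
Qed.

(** A functional separating [y] from [K] is nonzero, hence positive at [e], and can be rescaled into
    the dual base. *)
Lemma dual_base_cone e y : K° e ->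
  (forall w, dual_base K e w -> 0 <= dot w y) -> K y.
Proof.
move=> he h; apply: contrapT => /cone_separation[w Kw wy].
have w0 : w != 0.
  by apply: contraTneq wy => ->; rewrite dotC linear0 ltxx.
have we := dual_cone_interior_gt0 he Kw w0.
suff /h : dual_base K e ((dot w e)^-1 *: w).
  by rewrite [dot _ y]dotC linearZ /= pmulr_rge0 ?invr_gt0// dotC leNgt wy.
split => [k Kk|].
  by rewrite linearZ /= mulr_ge0 ?invr_ge0 ?Kw// ltW.
by rewrite [LHS]dotC linearZ /= [dot e w]dotC mulVf ?gt_eqF.
Qed.

Section Phi.
Variable e : 'rV[R]_m.
Hypothesis he : K° e.
Hypothesis C0 : dual_base K e !=set0.

Lemma dual_base_le w y (t : R) :
  dual_base K e w -> K (t *: e - y) -> dot w y <= t.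
Proof.
move=> [Kw we] /Kw; rewrite dotC linearB linearZ /= we.
by rewrite mulr1 subr_ge0.
Qed.

Lemma dot_le_phi w y : dual_base K e w -> dot w y <= phi K e y.
Proof.
move=> Cw; apply: ub_le_sup; last by exists w.
have [t _ Kt] := interior_cone_absorb hK y he.
by exists t => _ [u Cu <-]; exact: dual_base_le.
Qed.

Lemma phi_le y (t : R) : (forall w, dual_base K e w -> dot w y <= t) ->
  phi K e y <= t.
Proof.
move=> h; case: C0 => w0 Cw0; apply: ge_sup; first by exists (dot w0 y), w0.
by move=> _ [w Cw <-]; exact: h.
Qed.

(** If [u - y] has norm below [eps * r], then [eps *: e - (u - y)] is in [K], so no [w] of the base
    changes by more than [eps] from [y] to [u]. *)
Lemma phi_continuous : continuous (phi K e).
Proof.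
have [r r0 rK] := interior_coneP he.
have lip (eps : R) u y : 0 < eps -> `|u - y| < eps * r ->
    phi K e u <= phi K e y + eps.
  move=> e0 uy; apply: phi_le => w Cw.
  have : dot w (u - y) <= eps.
    apply: dual_base_le => //.
    rewrite (_ : _ - _ = eps *: (e - eps^-1 *: (u - y))); last first.
      by rewrite scalerBr scalerA divff ?gt_eqF// scale1r.
    apply: coneZ (ltW e0) _ => //; apply: rK.
    by rewrite normrZ gtr0_norm ?invr_gt0// mulrC ltr_pdivrMr// mulrC.
  by rewrite linearB /=; have := dot_le_phi y Cw; lra.
move=> y; apply/(@cvgrPdist_le _ _ _ _ (nbhs_filter y)) => eps e0.
apply: filterS (nbhsx_ballx y _ (mulr_gt0 e0 r0)) => u.
rewrite -ball_normE /= => yu; rewrite ler_distlC.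
have := lip eps y u e0 yu; rewrite distrC in yu.
by have := lip eps u y e0 yu; lra.
Qed.

End Phi.

(** The default value of [sup] on the empty set; a negative slope therefore forces a nonempty
    base. *)
Lemma phi_eq0 e y : ~ (dual_base K e !=set0) -> phi K e y = 0.
Proof.
move=> /set0P/negP; rewrite negbK => /eqP C0.
by rewrite /phi C0 image_set0 sup0.
Qed.

End Duality.

(** * Minimal elements of a finite set *)

(** Among the indices below [i], take [k] with the fewest indices below it. Any [l] below [k] has,
    by transitivity and cardinality, the same lower set as [k], so [k] is below [l] and antisymmetry
    gives equal values. *)
Lemma min_dominates (R : realType) m p (K : set 'rV[R]_m) (g : 'I_p -> 'rV[R]_m)
    (i : 'I_p) : ordering_cone K ->
  exists2 y, Min (range g) K y & K (g i - y).
Proof.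
move=> hK; pose below k := [set l | `[< K (g k - g l) >]]%SET.
have belowP k l : reflect (K (g k - g l)) (l \in below k).
  by rewrite /below inE; exact: asboolP.
have belowT k l l' : l \in below k -> l' \in below l -> l' \in below k.
  move=> /belowP kl /belowP ll'; apply/belowP.
  by have := coneD hK kl ll'; rewrite addrA subrK.
have belowR k : k \in below k by apply/belowP; rewrite subrr; exact: cone0 hK.
pose k := [arg min_(k < i | k \in below i) #|below k|]%N.
have [ik kmin] : k \in below i /\
    forall l, l \in below i -> (#|below k| <= #|below l|)%N.
  by rewrite /k; case: arg_minnP.
exists (g k); last exact/belowP.
split; first by exists k.
apply/seteqP; split=> [_ [[l _ <-] [c Kc gkc]]|_ ->]; last first.
  by split; [exists k|exists 0; [exact: cone0 hK|rewrite subr0]].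
have kl : l \in below k.
  by apply/belowP; rewrite -gkc opprB addrC subrK.
have sub : below l \subset below k.
  by apply/fintype.subsetP => l'; exact: belowT kl.
have := belowR k; rewrite -(_ : below l = below k); last first.
  by apply/eqP; rewrite eqEcard sub kmin// (belowT _ _ _ ik).
move=> /belowP lk; apply/eqP; rewrite -subr_eq0; apply/eqP.
by apply: (cone_antisym hK) lk _; rewrite opprB; exact/belowP.
Qed.

(** * Differential calculus along a line *)

Lemma mulmx_continuous (R : realType) n m (d : 'rV[R]_n) :
  continuous (fun M : 'M[R]_(n, m) => d *m M).
Proof.
have -> : (fun M : 'M[R]_(n, m) => d *m M) =
    (fun M => \sum_i \sum_j M i j *: (d *m delta_mx i j)).
  apply/funext => M; rewrite {1}[M]matrix_sum_delta mulmx_sumr.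
  apply: eq_bigr => i _; rewrite mulmx_sumr.
  by apply: eq_bigr => j _; rewrite -scalemxAr.
apply: (continuous_big add_continuous) => i _.
apply: (continuous_big add_continuous) => j _ M.
exact: (continuous_comp (@coord_continuous R n m i j M)
  (@scalel_continuous R _ _ _)).
Qed.

Section Line.
Variables (R : realType) (n m : nat) (g : 'rV[R]_n -> 'rV[R]_m).
Variables (x d : 'rV[R]_n).
Hypothesis hg : cont_diff g.

Lemma is_diff_line (t : R) :
  is_diff t (fun t : R => x + t *: d) (fun t : R => t *: d).
Proof.
have -> : (fun t : R => t *: d) = 0 + (fun t : R => t *: d).
  by apply/funext => s; rewrite /= add0r.
exact: is_diffD.
Qed.

Lemma diff_line_continuous :
  continuous (fun t : R => 'd g (x + t *: d) d).
Proof.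
have [_ cJ] := hg => t.
have cl : {for t, continuous (fun t : R => x + t *: d)}.
  by apply: differentiable_continuous; case: (is_diff_line t).
(* Through the Jacobian matrix, continuity of the derivative reduces to that of a matrix product. *)
have -> : (fun t : R => 'd g (x + t *: d) d) =
    (fun t : R => d *m jacobian g (x + t *: d)).
  by apply/funext => s; rewrite /jacobian mul_rV_lin1.
exact: (continuous_comp (continuous_comp cl (cJ _))
  (@mulmx_continuous R n m d _)).
Qed.

Lemma is_derive_dot_line w (t : R) :
  is_derive t 1 (fun t : R => dot w (g (x + t *: d)))
    (dot w ('d g (x + t *: d) d)).
Proof.
have [dg _] := hg.
have hl := is_diff_line t.
have hgd : is_diff (x + t *: d) g ('d g (x + t *: d)) by apply: DiffDef.
have hw : is_diff (g (x + t *: d)) (dot w) (dot w).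
  apply: DiffDef; first exact/linear_differentiable/dot_continuous.
  by rewrite diff_lin//; exact: dot_continuous.
have h := is_diff_comp (is_diff_comp hl hgd) hw.
apply: DeriveDef; first exact/diff_derivable.
by rewrite deriveE// diff_val /= scale1r.
Qed.

(** The mean value theorem for the scalar function [dot w (g (x + t *: d))] of [t]. *)
Lemma dot_line_le w (b c : R) : 0 <= b ->
  (forall t, 0 <= t <= b -> dot w ('d g (x + t *: d) d) <= c) ->
  dot w (g (x + b *: d)) <= dot w (g x) + c * b.
Proof.
move=> b0 hc.
have [|t tb] := MVT_segment b0 (fun t _ => is_derive_dot_line w t).
  apply: continuous_subspaceT => t.
  apply/differentiable_continuous/derivable1_diffP.
  by case: (is_derive_dot_line w t).
rewrite scale0r addr0 subr0 => /eqP; rewrite subr_eq => /eqP ->.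
by rewrite addrC lerD2l ler_wpM2r// hc//; move: tb; rewrite in_itv.
Qed.

End Line.

(** * First crossings and lower bounds *)

(** The crossing point is the least element of the compact set of [t] in [[0, b]] with
    [c <= M t]. *)
Lemma continuous_first_ge (R : realType) (M : R -> R) (c b : R) :
  continuous M -> M 0 < c -> 0 <= b -> c <= M b ->
  exists2 a, 0 < a & c <= M a /\ forall t, 0 <= t < a -> M t < c.
Proof.
move=> cM M0 b0 Mb; pose A := `[0, b]%classic `&` [set t | c <= M t].
have A0 : A !=set0 by exists b; split => //=; rewrite in_itv /= b0 lexx.
have cA : compact A.
  apply: compact_closedI; first exact: segment_compact.
  apply: (@preimage_closed _ _ M [set t | c <= t]); last exact: closed_ge.
  by move=> ? _; exact: cM.
have [a /set_mem[]] :=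
  compact_EVT_min A0 cA (continuous_subspaceT (fun t => @cvg_id _ (nbhs t))).
rewrite /= in_itv /= => /andP[a0 ab] Ma amin.
exists a.
  by rewrite lt_neqAle a0 andbT; apply: contraTneq Ma => <-; rewrite -ltNge.
split=> // t /andP[t0 ta]; rewrite ltNge; apply/negP => Mt.
have : t \in A.
  by apply/mem_set; split => //=; rewrite in_itv /= t0 (le_trans (ltW ta) ab).
by move=> /amin; rewrite leNgt ta.
Qed.

Lemma fmax_neq0_gt0 (R : realType) k (g : 'I_k -> R) : fmax g != 0 -> (0 < k)%N.
Proof.
case: k g => // g; suff -> : fmax g = 0 by rewrite eqxx.
rewrite /fmax -[RHS](@sup0 R); congr sup.
by rewrite -subset0 => t [[]].
Qed.

(** Every [y] in some [F x] is [b + k] with [b] in the bounded set [B] and [dot w k >= 0]. *)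
Lemma lower_le_dot_lbound (R : realType) m T (K B : set 'rV[R]_m)
    (F : T -> set 'rV[R]_m) (w : 'rV[R]_m) :
  bounded_set B -> (forall x, lower_le K B (F x)) -> dual_cone K w ->
  exists L : R, forall x y, F x y -> L <= dot w y.
Proof.
move=> bB BF Kw; have [c _ Bc] := pinfty_ex_gt0 bB.
exists (- ((\sum_i `|w ord0 i|) * c)) => x y /BF[b Bb [k /Kw wk <-]].
rewrite linearD /= (dotC w k) -[leLHS]addr0 lerD//.
rewrite lerNl; apply: le_trans (ler_norm _) _; rewrite normrN.
apply: le_trans (norm_dot_le w b) _.
by rewrite ler_wpM2l ?sumr_ge0//; exact: Bc.
Qed.

Lemma phi_diff_line_continuous (R : realType) n m (K : set 'rV[R]_m)
    (e : 'rV[R]_m) (g : 'rV[R]_n -> 'rV[R]_m) (x d : 'rV[R]_n) :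
  cont_diff g -> ordering_cone K -> K° e -> dual_base K e !=set0 ->
  continuous (fun t : R => phi K e ('d g (x + t *: d) d)).
Proof.
move=> hg hK he C0 t.
have cd := @diff_line_continuous R n m _ x d hg t.
have cp := phi_continuous hK he C0.
exact: (@continuous_comp _ _ _ _ _ t cd (cp _)).
Qed.

(** * Construction of the interval of strong Wolfe steps *)

Theorem theorem3p1 (R : realType) (n m p : nat)
    (K : set 'rV[R]_m) (hK : ordering_cone K)
    (f : 'I_p -> 'rV[R]_n -> 'rV[R]_m) (hf : forall i, cont_diff (f i))
    (e : 'rV[R]_m) (he : (K°) e)
    (xbar : 'rV[R]_n)
    (v : 'I_(omega K f xbar) -> 'rV[R]_m) (hv : enum_Min v)
    (hx : ~ stationary v)
    (abar : 'I_(omega K f xbar) -> 'I_p) (ubar : 'rV[R]_n)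
    (hmin : V_minimizer e v abar ubar)
    (dbar : 'rV[R]_n) (hd : max_slope K f e abar xbar dbar < 0)
    (hB : exists B : set 'rV[R]_m,
        bounded_set B /\ forall x, lower_le K B (Fset f x))
    (rho sigma : R) (hrho : 0 < rho < 1) (hsigma : rho < sigma < 1) :
  exists I : set R,
    [/\ is_interval I, I° !=set0, I `<=` [set t | 0 < t] &
      forall alpha, I alpha ->
        let W := [set f (abar j) xbar
                   + (rho * alpha * max_slope K f e abar xbar dbar) *: e
                 | j in [set: 'I_(omega K f xbar)]] in
        [/\ lower_le K (Fset f (xbar + alpha *: dbar)) W,
            lower_lt K W (Fset f xbar) &
            `| max_slope K f e abar (xbar + alpha *: dbar) dbar |
              <= sigma * `| max_slope K f e abar xbar dbar | ] ].
Proof.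
have [Pabar _] := hmin; move: hrho hsigma => /andP[rho0 rho1] /andP[rs s1].
set D := max_slope K f e abar xbar dbar in hd *.
(* An empty maximum would be 0, contradicting [D < 0]. *)
have omega0 : (0 < omega K f xbar)%N.
  by apply: (@fmax_neq0_gt0 R _ (fun j => phi K e ('d (f (abar j)) xbar dbar)));
    rewrite lt_eqF.
have C0 : dual_base K e !=set0.
  apply: contrapT => /phi_eq0 phi0; move: hd; rewrite /D /max_slope.
  have [[j ->] _] := fmaxP
    (fun j => phi K e ('d (f (abar j)) xbar dbar)) omega0.
  by rewrite phi0 ltxx.
pose M (t : R) := max_slope K f e abar (xbar + t *: dbar) dbar.
have M0 : M 0 = D by rewrite /M scale0r addr0.
have cM : continuous M.
  apply: (fmax_continuous (g := fun j t =>
    phi K e ('d (f (abar j)) (xbar + t *: dbar) dbar))) => j t.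
  exact: (phi_diff_line_continuous (hf (abar j)) hK he C0).
have dot_le j w (c b : R) : dual_base K e w -> 0 <= b ->
    (forall t, 0 <= t <= b -> M t <= c) ->
    dot w (f (abar j) (xbar + b *: dbar)) <= dot w (f (abar j) xbar) + c * b.
  move=> Cw b0 Mc; apply: (dot_line_le (hf (abar j)) b0) => t tb.
  apply: le_trans (Mc t tb).
  apply: le_trans (dot_le_phi hK he _ Cw) _.
  by have [_] := fmaxP (fun j =>
    phi K e ('d (f (abar j)) (xbar + t *: dbar) dbar)) omega0; exact.
have ME t : max_slope K f e abar (xbar + t *: dbar) dbar = M t := erefl.
clearbody M D.
have rD0 : rho * D < 0 by rewrite pmulr_rlt0.
have [b b0 Mb] : exists2 b, 0 <= b & rho * D <= M b.
  apply: contrapT => nb.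
  have Mlt t : 0 <= t -> M t <= rho * D.
    by move=> t0; rewrite leNgt; apply/negP => /ltW ?; apply: nb; exists t.
  have [B [bB BF]] := hB; have [w Cw] := C0.
  have [L FL] := lower_le_dot_lbound bB BF Cw.1.
  pose j := Ordinal omega0; pose v0 := dot w (f (abar j) xbar).
  have Lv0 : L <= v0 by apply: (FL xbar); exists (abar j).
  (* Chosen so that the mean value bound [v0 + rho * D * b] equals [L - 1], one below the lower
     bound [L]. *)
  pose b := (L - 1 - v0) / (rho * D).
  have b0 : 0 <= b by rewrite /b -mulrNN -invrN mulr_ge0 ?invr_ge0; lra.
  have bE : rho * D * b = L - 1 - v0 by rewrite /b mulrC divfK// lt_eqF.
  have := dot_le j w (rho * D) b Cw b0 (fun t tb => Mlt t (proj1 (andP tb))).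
  rewrite bE -/v0; apply/negP; rewrite -ltNge.
  have := FL (xbar + b *: dbar) _ (ex_intro2 _ _ (abar j) I erefl); lra.
have [a a0 [Ma Mlt]] : exists2 a, 0 < a &
    rho * D <= M a /\ forall t, 0 <= t < a -> M t < rho * D.
  by apply: continuous_first_ge b0 Mb => //; rewrite M0; nra.
have [r r0 Mr] : exists2 r : R, 0 < r &
    forall t, `|a - t| < r -> sigma * D < M t.
  (* As [D < 0], [rho < sigma] gives the strict gap [sigma * D < rho * D], which continuity
     preserves near [a]. *)
  have sM : sigma * D < M a by apply: lt_le_trans Ma; nra.
  have aM : \forall t \near a, sigma * D < M t by exact: cvgr_gt (cM a) _ sM.
  have [r r0 h] := (nbhs_ballP _ _).1 aM.
  by exists r => // t at_; apply: h; rewrite -ball_normE.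
pose l := Num.max 0 (a - r).
have la : l < a by rewrite /l gt_max a0 gtrBl.
exists `]l, a[%classic; split.
- exact: interval_is_interval.
- have /interior_id -> : open (`]l, a[%classic : set R) by exact: itv_open.
  by exists ((l + a) / 2); rewrite /= in_itv /= !midf_lt.
- move=> t; rewrite /= in_itv /= => /andP[+ _].
  by rewrite /l gt_max => /andP[].
move=> t; rewrite /= in_itv /= /l gt_max => /andP[/andP[t0 art] ta].
have Mt : M t < rho * D by apply: Mlt; rewrite ltW.
split.
- move=> _ [j _ <-].
  exists (f (abar j) (xbar + t *: dbar)); first by exists (abar j).
  exists (f (abar j) xbar + (rho * t * D) *: e - f (abar j) (xbar + t *: dbar));
    last by rewrite addrC subrK.
  (* Since [dot w e = 1], membership in [K] becomes the scalar decrease estimate for each [w]. *)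
  apply: (dual_base_cone hK he) => w Cw.
  have := dot_le j w (rho * D) t Cw (ltW t0).
  rewrite linearB linearD linearZ /= Cw.2 mulr1 subr_ge0 mulrAC; apply.
  by move=> s /andP[s0 st]; rewrite ltW// Mlt// s0 (le_lt_trans st).
- move=> _ [i _ <-].
  have [y minF Ky] := min_dominates (f ^~ xbar) i hK.
  (* The minimal [y] is some [v j], which is the value of [f (abar j)] at [xbar]; the shift by the
     positive multiple [- (rho * t * D)] of [e] then moves the difference into the interior. *)
  have [_ _ vsurj] := hv; have [j _ vj] := vsurj _ minF.
  exists (f (abar j) xbar + (rho * t * D) *: e); first by exists j.
  exists (f i xbar - y - (rho * t * D) *: e).
    rewrite -scaleNr; apply: (cone_interiorD hK) => //.
    by rewrite oppr_gt0 mulrAC pmulr_llt0.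
  by rewrite (Pabar j) vj; apply/rowP => q; rewrite !mxE; ring.
(* Both slopes are negative, so the curvature condition reads [sigma * D <= M t]. *)
- rewrite ME !ltr0_norm//; last exact: lt_trans Mt rD0.
  rewrite mulrN lerN2 ltW// Mr// ltr_distlC; lra.
Qed.
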